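(* A generalized dicyclic $2$-group $G$ satisfies $\alpha(G)=\frac{3}{4}$ if and only if there is $n\in\mathbb{N}$ such that $G\cong\mathbb{Z}_2^n\times\mathbb{Z}_4$.
   Context: For a finite group $G$, $L_1(G)$ denotes the set (poset) of cyclic subgroups of $G$ (including the trivial subgroup), and $\alpha(G)=\frac{|L_1(G)|}{|G|}$. Let $k\ge 2$ be an integer and $A$ an abelian group of order $2^{k-1}$. A generalized dicyclic group of order $2^k$ associated to $A$ is a group of order $2^k$ of the form $Dic_{2^k}(A)=\langle A,\gamma \mid \gamma^4=1,\ \gamma^2\in A\setminus\{1\},\ \gamma g=g^{-1}\gamma\ \forall\, g\in A\rangle$, that is, a group of order $2^k$ containing $A$ as a subgroup of index $2$ and generated by $A$ and an element $\gamma\notin A$ such that $\gamma^4=1$, $\gamma^2$ is a non-trivial element of $A$, and $\gamma g=g^{-1}\gamma$ for all $g\in A$. A generalized dicyclic $2$-group is any such group. $\mathbb{Z}_m$ is the cyclic group of order $m$, and $\mathbb{N}$ includes $0$. *)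

(* Defs.v *)
From mathcomp Require Import all_boot all_order all_algebra.
From mathcomp Require Import all_fingroup all_solvable.

Set Implicit Arguments.
Unset Strict Implicit.
Unset Printing Implicit Defensive.

Import GRing.Theory GroupScope.

Section Defs.
Variable gT : finGroupType.
Implicit Types A G : {group gT}.

Definition cyclic_subgroups G : {set {group gT}} :=
  [set H in subgroups G | cyclic H].

Definition alpha G : rat :=
  (#|cyclic_subgroups G|%:R / #|G|%:R)%R.

Definition gen_dicyclic (k : nat) A G : Prop :=
  [/\ #|G| = (2 ^ k)%N, #|A| = (2 ^ k.-1)%N, abelian A, A \subset G
    & exists gamma : gT,
        [/\ gamma \in G :\: A,
            <<gamma |: A>> = G,
            gamma ^+ 4 = 1,
            gamma ^+ 2 \in A^#
          & {in A, forall g, gamma * g = g^-1 * gamma}]].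

Definition gen_dicyclic_2group G : Prop :=
  exists k A, 2 <= k /\ gen_dicyclic k A G.

End Defs.

(* The group law is pointwise on the functions 'I_n -> 'Z_2, and is the
   addition on 'Z_2 and 'Z_4; for n = 0 the first factor is trivial. *)
Definition Z2n_Z4 (n : nat) : finGroupType :=
  ({dffun forall _ : 'I_n, 'Z_2} * 'Z_4)%type.

(* Main.v *)
Require Import Defs.
From mathcomp Require Import all_boot all_order all_algebra.
From mathcomp Require Import all_fingroup all_solvable.
From mathcomp Require Import zify.

(** Write G = A U At, where the abelian group A has index 2 and t inverts A.
    Every element x = at outside A has x ^ 2 = a (t a t^-1) t ^ 2 = t ^ 2, an
    involution, so x has order 4.  The |G| / 2 elements outside A are thus
    paired off as generators of |G| / 4 cyclic subgroups, while the remaining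
    cyclic subgroups are those of A; hence alpha(G) = alpha(A) / 2 + 1 / 4, and
    alpha(G) = 3 / 4 exactly when alpha(A) = 1 ([alpha_3_4_eq]).  Since x and
    x^-1 generate the same subgroup, alpha(A) = 1 says precisely that every
    element of A squares to 1 ([card_cyclic_subgroups_eqP]).

    That condition on A is in turn equivalent to G being abelian, because
    conjugation by t is inversion on A.  If it holds, G is abelian of
    exponent 4, so the cyclic subgroup <[t]> of maximal order is a direct
    factor; a square in a complement K is 1 or t ^ 2, and t ^ 2 lies in <[t]>,
    so K is elementary abelian ([complement_abelem]) and G is isomorphic to
    Z2n_Z4 n with |K| = 2 ^ n.  Conversely Z2n_Z4 n is abelian, which is all
    that has to be transported along an isomorphism. *)
Set Implicit Arguments.
Unset Strict Implicit.
Unset Printing Implicit Defensive.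

Import GRing.Theory Num.Theory GroupScope.

(** * Counting cyclic subgroups *)

Section CyclicSubgroups.
Variable gT : finGroupType.
Implicit Types A G : {group gT}.

Lemma cyclic_subgroupsE G : cyclic_subgroups G = [set <[x]>%G | x in G].
Proof.
apply/setP=> H; rewrite inE; apply/andP/imsetP=> [[sHG /cyclicP[x defH]]|[x Gx ->]].
  exists x; last exact/val_inj.
  by move: sHG; rewrite inE defH cycle_subG.
by rewrite inE cycle_subG Gx cycle_cyclic.
Qed.

(** The map x |-> <[x]> onto the cyclic subgroups is injective iff no x differs
    from x^-1: a cyclic group of order at most 2 has a single generator. *)
Lemma card_cyclic_subgroups_eqP G :
  reflect {in G, forall x, x ^+ 2 = 1} (#|cyclic_subgroups G| == #|G|).
Proof.
rewrite cyclic_subgroupsE; apply: (iffP imset_injP) => [inj x Gx | sq1 x y Gx Gy].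
  have eq_xV : x = x^-1.
    by apply: inj; rewrite ?groupV //; apply: val_inj; rewrite /= cycleV.
  by rewrite expg2 {1}eq_xV mulVg.
move=> /(congr1 val) /= eq_xy.
have /cycleP[i def_y] : y \in <[x]> by rewrite eq_xy cycle_id.
have {def_y} : y = x ^+ (i %% 2) by rewrite def_y expg_mod ?sq1.
rewrite modn2; case: (odd i) => // y1.
by apply/eqP; rewrite y1 -cycle_eq1 eq_xy y1 cycle1.
Qed.

(** All the generators of a cyclic subgroup lie on the same side of A. *)
Lemma card_cyclic_subgroups_subgroup A G :
    A \subset G ->
  #|cyclic_subgroups G| = #|cyclic_subgroups A| + #|[set <[x]>%G | x in G :\: A]|.
Proof.
move=> sAG; rewrite !cyclic_subgroupsE -{1}(setID G A) (setIidPr sAG) imsetU cardsU.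
rewrite (_ : _ :&: _ = set0) ?cards0 ?subn0 //.
apply/setP=> H; rewrite !inE; apply/negP=> /andP[/imsetP[x Ax ->]].
case/imsetP=> y /setDP[_ /negP notAy] /(congr1 val) /= eq_xy; case: notAy.
by rewrite -cycle_subG -eq_xy cycle_subG.
Qed.

(** A cyclic group of order 4 has totient 4 = 2 generators, and if one of them
    is outside A then so is the other. *)
Lemma card_cycles_order4 A G :
    {in G :\: A, forall x, #[x] = 4} ->
  #|G :\: A| = (#|[set <[x]>%G | x in G :\: A]| * 2)%N.
Proof.
move=> o4; rewrite -sum1_card (partition_big_imset (fun x => <[x]>%G)) /=.
rewrite -sum_nat_const; apply: eq_bigr => _ /imsetP[x GAx ->].
have /setDP[Gx notAx] := GAx.
have <- : totient #[x] = 2 by rewrite o4.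
rewrite totient_gen -sum1_card.
apply: eq_bigl => y; rewrite !inE -val_eqE /= [RHS]eq_sym andb_idl // => /eqP eq_yx.
rewrite -!cycle_subG eq_yx !cycle_subG; exact/andP.
Qed.

End CyclicSubgroups.

(** Here 4 |L1(G)| = 4 |L1(A)| + 2 |A| whereas 3 |G| = 6 |A|. *)
Lemma alpha_3_4_eq (gT : finGroupType) (A G : {group gT}) :
    A \subset G -> #|G : A| = 2 -> {in G :\: A, forall x, #[x] = 4} ->
  alpha G = (3%:R / 4%:R)%R <-> #|cyclic_subgroups A| = #|A|.
Proof.
move=> sAG iAG o4.
have cG := card_cyclic_subgroups_subgroup sAG.
have cO := card_cycles_order4 o4.
have oG := Lagrange sAG; rewrite iAG in oG.
have oO : #|G :\: A| = #|A| by rewrite cardsD (setIidPr sAG) -oG; lia.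
have A_gt0 : (0 < #|A|)%N := cardG_gt0 A.
have -> : alpha G = (3%:R / 4%:R)%R <-> (#|cyclic_subgroups G| * 4 = 3 * #|G|)%N.
  have G_neq0 : (#|G|%:R != 0 :> rat)%R by rewrite pnatr_eq0 -lt0n cardG_gt0.
  rewrite /alpha (rwP eqP) eqr_div // -!natrM eqr_nat.
  by split=> /eqP.
lia.
Qed.

(** * A subgroup of index 2 inverted by an outer element *)

Section InvertedSubgroup.
Variables (gT : finGroupType) (A G : {group gT}) (t : gT).
Hypotheses (iAG : #|G : A| = 2) (sAG : A \subset G) (GAt : t \in G :\: A).
Hypothesis invA : {in A, forall g, t * g = g^-1 * t}.

Lemma sqr_outside_inverted x : x \in G :\: A -> x ^+ 2 = t ^+ 2.
Proof.
rewrite -(rcoset_index2 sAG iAG GAt) => /rcosetP[a Aa ->].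
by rewrite !expg2 -mulgA (mulgA t) invA // -mulgA mulKVg.
Qed.

Lemma order_outside_inverted x :
  t ^+ 4 = 1 -> t ^+ 2 != 1 -> x \in G :\: A -> #[x] = 4.
Proof.
move=> t4 t2 /sqr_outside_inverted x2.
apply: (@orderXprime _ 2 2) => //; rewrite x2.
by apply: nt_prime_order; rewrite -?expgM.
Qed.

Lemma abelian_inverted_sqr1 :
  abelian G -> {in A, forall g, g ^+ 2 = 1}.
Proof.
move=> abG g Ag; have /setDP[Gt _] := GAt.
have /mulIg gV : g^-1 * t = g * t.
  by rewrite -invA // (centsP abG t Gt g) ?(subsetP sAG).
by rewrite expg2 -{1}gV mulVg.
Qed.

Lemma abelian_of_inverted_sqr1 :
  <<t |: A>> = G -> abelian A -> {in A, forall g, g ^+ 2 = 1} ->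
  abelian G.
Proof.
move=> genG abA sq1; rewrite -genG -[<<_>>]/([set t] <*> A) -joing_idl.
have cAt : A \subset 'C[t].
  apply/subsetP=> g Ag; apply/cent1P; rewrite /commute invA //.
  by rewrite -[g^-1]mul1g -(sq1 g Ag) expg2 mulgK.
by rewrite abelianY cycle_abelian abA cent_cycle.
Qed.

(** The order 4 of t is the exponent of G, so <[t]> splits off; the square of an
    element of a complement K is 1 or t ^ 2, and lies in K :&: <[t]> = 1. *)
Lemma complement_abelem :
    abelian G -> {in A, forall g, g ^+ 2 = 1} -> t ^+ 4 = 1 -> t ^+ 2 != 1 ->
  exists2 K : {group gT}, <[t]> \x K = G & 2.-abelem K.
Proof.
move=> abG sq1 t4 t2; have /setDP[Gt _] := GAt.
have sqG x : x \in G -> x ^+ 2 = 1 \/ x ^+ 2 = t ^+ 2.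
  move=> Gx; have [/sq1|notAx] := boolP (x \in A); first by left.
  by right; apply: sqr_outside_inverted; rewrite inE notAx.
have ot : #[t] = 4 by apply: order_outside_inverted.
have expG : #[t] = exponent G.
  apply/eqP; rewrite eqn_dvd dvdn_exponent //= ot; apply/exponentP=> x /sqG.
  by rewrite (expgM x 2 2) => -[] ->; rewrite ?expg1n // -expgM.
have /splitsP[K /complP[tiK defG]] := abelian_splits Gt expG abG.
have sKG : K \subset G by rewrite -defG mulG_subr.
exists K.
  by rewrite dprodE ?defG // (sub_abelian_cent2 abG) ?cycle_subG.
rewrite abelemE // (abelianS sKG) //=; apply/exponentP=> x Kx.
have [//|x2] := sqG x (subsetP sKG x Kx).
by apply/set1gP; rewrite -tiK inE {1}x2 mem_cycle groupX.
Qed.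

End InvertedSubgroup.

(** * The model group *)

Lemma abelem_Z2n n : 2.-abelem [set: {dffun forall _ : 'I_n, 'Z_2}].
Proof.
rewrite abelemE //; apply/andP; split.
  by apply/centsP=> x _ y _; apply/ffunP=> i; rewrite !mulg_ffun; exact: addrC.
apply/exponentP=> x _; apply/ffunP=> i.
by rewrite expg2 mulg_ffun oneg_ffun; case: (x i) => -[|[|m]] // lt_m; apply/val_inj.
Qed.

Lemma isog_Z2n_Z4 (gT : finGroupType) (G K : {group gT}) t :
  <[t]> \x K = G -> #[t] = 4 -> 2.-abelem K -> exists n, G \isog [set: Z2n_Z4 n].
Proof.
move=> defG ot abK; set n := logn 2 #|K|; exists n.
have cardK : #|K| = (2 ^ n)%N := card_pgroup (abelem_pgroup abK).
have setXT : [set: Z2n_Z4 n] = setX [set: {dffun forall _ : 'I_n, 'Z_2}] [set: 'Z_4].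
  by apply/setP=> u; rewrite !inE.
rewrite dprodC in defG; rewrite setXT.
apply: (isog_dprod defG (setX_dprod _ _)).
  apply: isog_trans (isog_setX1 _ _); rewrite (isog_abelem_card _ abK) abelem_Z2n.
  by rewrite cardK cardsT (card_ffun 'I_n 'Z_2) !card_ord eqxx.
apply: isog_trans (isog_set1X _ _).
have cyclicZ4 : cyclic [set: 'Z_4] by rewrite Zp_cycle cycle_cyclic.
rewrite (isog_cyclic_card _ (cycle_cyclic t)) cyclicZ4.
by rewrite cardsT card_ord -orderE ot.
Qed.

Lemma abelian_Z2n_Z4 n : abelian [set: Z2n_Z4 n].
Proof.
apply/centsP=> -[x a] _ [y b] _; congr pair; last exact: addrC.
by apply: (centsP (abelem_abelian (abelem_Z2n n))); rewrite inE.
Qed.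

Theorem theorem3p4 (gT : finGroupType) (G : {group gT}) (hG : gen_dicyclic_2group G) :
  alpha G = (3%:R / 4%:R)%R <-> exists n : nat, G \isog [set: Z2n_Z4 n].
Proof.
have [k [A [k_gt1 [oG oA abA sAG [t [GAt genG t4 /setD1P[t2 _] invA]]]]]] := hG.
have iAG : #|G : A| = 2.
  rewrite -divgS // oG oA -[k in X in X %/ _](ltn_predK k_gt1) expnS.
  by rewrite mulnK ?expn_gt0.
have o4 x : x \in G :\: A -> #[x] = 4 by apply: (order_outside_inverted (t := t)).
rewrite (alpha_3_4_eq sAG iAG o4); split=> [/eqP/card_cyclic_subgroups_eqP sq1 | [n isoG]].
  have abG := abelian_of_inverted_sqr1 invA genG abA sq1.
  have [K defG abK] := complement_abelem iAG sAG GAt invA abG sq1 t4 t2.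
  exact: isog_Z2n_Z4 defG (o4 _ GAt) abK.
have abG : abelian G by rewrite (isog_abelian isoG) abelian_Z2n_Z4.
exact/eqP/card_cyclic_subgroups_eqP/(abelian_inverted_sqr1 sAG GAt invA).
Qed.
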